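(* For every $m\in\mathbb{N}$, $w(\Lambda_m|\mathcal{F}_m)\ge 1.34$, where $\mathcal{F}_m$ is the explicit class of functions defined in the context.
   Context: $\mathbb{N}=\{1,2,3,\dots\}$; $|\cdot|$ applied to a set denotes Lebesgue measure; $\mathbf 1$ denotes an indicator function. For $m\in\mathbb{N}$ and $f\in L^1([0,\infty))$, $$\Lambda_m f(t)=\frac{1+m}{t^{1+m/2}}\int_0^t f(s)s^{m/2}\,ds-f(t),\qquad t>0.$$ For an operator $T$ on $L^1([0,\infty))$ and a class $\mathcal{F}\subset L^1([0,\infty))$, $$w(T|\mathcal{F})=\sup\Bigl\{\frac{|\{t\in[0,\infty):|Tf(t)|\ge 1\}|}{\|f\|_{L^1([0,\infty))}}: f\in\mathcal{F},\ \|f\|_{L^1([0,\infty))}\ne 0\Bigr\}.$$ Class $\mathcal{F}_m$: all functions $f:[0,\infty)\to\mathbb{R}$ of the form $$f(t)=\Bigl(\tfrac{2+m}{m}-\tfrac{2(1+m)}{m}t^{m/2}\Bigr)\mathbf 1_{\{t\in(1,b]\}}+\Bigl(-\tfrac{2+m}{m}+D\,t^{m/2}\Bigr)\mathbf 1_{\{t\in(b,d]\}}$$ for some $1<b<d$, where $D=D(b,m)=\frac{2(1+m)}{m}(2b^{-m/2}-1)$, and such that $D>0$ and $$-\tfrac{2+m}{m}+D\,b^{m/2}<0<-\tfrac{2+m}{m}+D\,d^{m/2}<2.$$ *)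

(* Defs.v *)
From HB Require Import structures.
From mathcomp Require Import all_boot all_order all_algebra.
From mathcomp Require Import all_classical all_reals all_analysis.

Set Implicit Arguments.
Unset Strict Implicit.
Unset Printing Implicit Defensive.

Import Order.TTheory GRing.Theory Num.Theory.
Import numFieldNormedType.Exports.

Local Open Scope classical_set_scope.
Local Open Scope ring_scope.

(* A function on [0, oo) is represented by a function R -> R whose values at
   negative arguments are never used. *)

Definition halfline (R : realType) : set R := `[0, +oo[%classic.
Arguments halfline R : clear implicits.

Definition norm1 (R : realType) (f : R -> R) : \bar R :=
  (\int[@lebesgue_measure R]_(t in halfline R) `|f t|%:E)%E.

Definition L1 (R : realType) : set (R -> R) :=
  [set f | (@lebesgue_measure R).-integrable (halfline R) (EFin \o f)].
Arguments L1 R : clear implicits.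

(* Only meaningful for 0 < t; at the null point t = 0 the convention 0^-1 = 0
   gives - f 0. *)
Definition Lambda (R : realType) (m : nat) (f : R -> R) (t : R) : R :=
  (1 + m%:R) / t `^ (1 + m%:R / 2)
    * (\int[@lebesgue_measure R]_(s in `[0, t]) (f s * s `^ (m%:R / 2)))
  - f t.

(* The classes of interest are included in L^1, in which case the
   intersection with L1 R is redundant. *)
Definition weak_const (R : realType) (T : (R -> R) -> (R -> R))
    (F : set (R -> R)) : \bar R :=
  ereal_sup
    [set (@lebesgue_measure R
            [set t : R | halfline R t /\ (1 <= `|T f t|)%R] / norm1 f)%E
     | f in [set f | (F `&` L1 R) f /\ norm1 f <> 0%E]].

Definition Dcoef (R : realType) (m : nat) (b : R) : R :=
  2 * (1 + m%:R) / m%:R * (2 * b `^ (- (m%:R / 2)) - 1).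

Definition Fclass (R : realType) (m : nat) : set (R -> R) :=
  [set f | exists b d : R,
    [/\ 1 < b, b < d, 0 < Dcoef m b,
        - ((2 + m%:R) / m%:R) + Dcoef m b * b `^ (m%:R / 2) < 0
          /\ 0 < - ((2 + m%:R) / m%:R) + Dcoef m b * d `^ (m%:R / 2) < 2
      & forall t : R, 0 <= t ->
        f t = ((2 + m%:R) / m%:R
                 - 2 * (1 + m%:R) / m%:R * t `^ (m%:R / 2))
                * \1_(`]1, b]%classic) t
              + (- ((2 + m%:R) / m%:R) + Dcoef m b * t `^ (m%:R / 2))
                * \1_(`]b, d]%classic) t]].
Arguments Fclass R m : clear implicits.

(* Main.v *)
Require Import Defs.
From HB Require Import structures.
From mathcomp Require Import all_boot all_order all_algebra.
From mathcomp Require Import all_classical all_reals all_analysis.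
From mathcomp Require Import lra.

Import Order.TTheory GRing.Theory Num.Theory.
Import numFieldNormedType.Exports.
Local Open Scope classical_set_scope.
Local Open Scope ring_scope.

(** Write p = m/2, e = 1/p and u = 1 + e, so that (2+m)/m = u and
    2(1+m)/m = 1 + u.  A function f of the class satisfies Lambda f = 1 on
    (1,b] and Lambda f = -1 on (b,d], hence the level set contains (1,d] and
    it suffices to find b, d with (d - 1) / ||f|| >= 1.34.  Take
      b^p = 3 y,  y = 2(2+e)/(7+4e),      d^p = 3 z,  z = 1 + 3/(4(1+e)),
    which gives D = u/3, so f vanishes at c = 3^e, and f(d) = 3/4.  Integrating
    |f| over (1,b], (b,c], (c,d] gives
      u ||f|| = 2 u c - 2 b + 1 - d (u - 3e/4).
    Dividing by c, what remains is an inequality between 3^(-e), y^e and z^e.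
    It holds with margin about e/32 as e -> 0; for m >= 5 Taylor polynomials
    of the exponentials are precise enough, and for m <= 4 raising to the power
    m turns it into rational arithmetic. *)

(** * Taylor bounds for the exponential and numerical bounds for logarithms *)

Lemma expR_ge_partial_sum (R : realType) (x : R) (n : nat) : 0 <= x ->
  \sum_(k < n) x ^+ k / k`!%:R <= expR x.
Proof.
move=> x0; rewrite -(big_mkord predT (fun k => x ^+ k / k`!%:R)).
apply: (@nondecreasing_cvgn_le _ (series (exp_coeff x))) => [i j ij|].
  rewrite /series/= (big_cat_nat (leq0n i) ij)/= lerDl sumr_ge0// => k _.
  by rewrite divr_ge0// exprn_ge0.
exact: is_cvg_series_exp_coeff.
Qed.

(** Induction on n: the signed remainder of order n + 1 vanishes at 0 and its derivative is the
    signed remainder of order n, so it is nondecreasing on the half-line. Even n thus bounds exp(-x)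
    from below and odd n from above. *)
Lemma alternating_partial_sum_expRN (R : realType) (n : nat) (x : R) :
  0 <= x -> 0 <= (-1) ^+ n * (expR (- x) - \sum_(k < n) (- x) ^+ k / k`!%:R).
Proof.
elim: n x => [x _|n IH x x0].
  by rewrite big_ord0 subr0 expr0 mul1r expR_ge0.
pose S N (y : R) : R := \sum_(k < N) (- y) ^+ k / k`!%:R.
pose g N (y : R) : R := (-1) ^+ N * (expR (- y) - S N y).
have dS (y : R) : is_derive y 1 (S n.+1) (- S n y).
  have -> : S n.+1 = \sum_(k < n.+1) (fun y : R => (- y) ^+ k / k`!%:R).
    by apply/funext => z; rewrite /S fct_sumE.
  have dT (k : nat) : is_derive y 1 (fun y : R => (- y) ^+ k / k`!%:R)
      (- (k%:R * (- y) ^+ k.-1 / k`!%:R)).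
    (* A scalar multiple of a power of [- id] is a form whose derivative is found by inference. *)
    have -> : (fun y : R => (- y) ^+ k / k`!%:R) =
        (k`!%:R^-1 : R) *: ((- id : R -> R) ^+ k).
      by apply/funext => z; rewrite scalrfctE exprfctE /GRing.scale/= mulrC.
    apply: is_derive_eq.
    by rewrite /GRing.scale/= mulr_natl !mulrN mulr1 mulrC.
  apply: is_derive_eq.
  rewrite big_ord_recl/= mul0r mul0r oppr0 add0r -sumrN.
  apply: eq_bigr => k _; congr (- _); rewrite /bump/= add1n factS natrM.
  by rewrite invfM mulrACA mulfV ?mul1r// pnatr_eq0.
have dg (y : R) : is_derive y 1 (g n.+1) (g n y).
  apply: is_derive_eq.
  by rewrite /g exprS /GRing.scale/=; lra.
have g0 : g n.+1 0 = 0.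
  rewrite /g /S oppr0 expR0 big_ord_recl/= expr0 divr1 big1 ?addr0 ?subrr ?mulr0//.
  by move=> i _; rewrite /bump/= expr0n/= mul0r.
rewrite -[_ * _]/(g n.+1 x) -g0.
apply: (@ger0_derive1_ndecr _ _ 0 x) => //.
- by move=> y; rewrite in_itv/= => /andP[y0 _]; rewrite derive1E derive_val IH// ltW.
- by apply: derivable_within_continuous => y _.
Qed.

(* 7! is left as a product: numerals above 5000 are not parsed in unary, and
   [lra] does not see through the resulting [Nat.of_num_uint]. *)
Definition small_factorialE := (erefl : 0`! = 1%N, erefl : 1`! = 1%N,
  erefl : 2`! = 2%N, erefl : 3`! = 6%N, erefl : 4`! = 24%N,
  erefl : 5`! = 120%N, erefl : 6`! = 720%N, erefl : 7`! = (7 * 720)%N).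

(** Equivalent to 1/3 <= exp(-1.098), which the partial sum with 8 terms gives. *)
Lemma ln3_ge (R : realType) : 1098 / 1000 <= ln (3 : R).
Proof.
rewrite -[_ / _]expRK ler_ln ?posrE ?expR_gt0//.
rewrite -[expR _]invrK -[leRHS]invrK -expRN lef_pV2 ?posrE ?invr_gt0 ?expR_gt0//.
have x0 : 0 <= 1098 / 1000 :> R by lra.
have := @alternating_partial_sum_expRN R 8 _ x0.
rewrite !big_ord_recr big_ord0 /= !small_factorialE ?natrM.
by set a := expR _ => ?; lra.
Qed.

(** As e tends to 0 the bases z and y tend to 7/4 and 4/7, so this one logarithm controls both z^e
    and y^e. Its bounds are read off exp(-0.559) >= 4/7 and exp(-0.56) <= 4/7. *)
Lemma ln_7_4_bounds (R : realType) : 559 / 1000 <= ln (7 / 4 : R) <= 56 / 100.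
Proof.
have h : 0 < 7 / 4 :> R by lra.
have -> : ln (7 / 4 : R) = - ln (4 / 7) by rewrite -lnV ?posrE ?invf_div.
have h' : 0 < 4 / 7 :> R by lra.
rewrite lerNr lerNl -[- (559 / 1000)]expRK -[- (56 / 100)]expRK.
rewrite !ler_ln ?posrE ?expR_gt0//.
have x0 : 0 <= 559 / 1000 :> R by lra.
have y0 : 0 <= 56 / 100 :> R by lra.
have := @alternating_partial_sum_expRN R 6 _ x0.
have := @alternating_partial_sum_expRN R 7 _ y0.
rewrite !big_ord_recr !big_ord0 /= !small_factorialE.
by set a := expR _; set b := expR _ => ? ?; lra.
Qed.

Lemma powR_expR_ln (R : realType) (x y : R) : 0 < x -> x `^ y = expR (y * ln x).
Proof. by move=> x0; rewrite /powR gt_eqF. Qed.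

Lemma expR_ge_quadratic (R : realType) (x : R) : 0 <= x ->
  1 + x + x ^+ 2 / 2 <= expR x.
Proof.
move=> x0; have := expR_ge_partial_sum _ _ 3 x0.
by rewrite !big_ord_recr big_ord0 /= !small_factorialE; lra.
Qed.

Lemma expRN_le_quadratic (R : realType) (x : R) : 0 <= x ->
  expR (- x) <= 1 - x + x ^+ 2 / 2.
Proof.
move=> x0; have := alternating_partial_sum_expRN _ 3 _ x0.
by rewrite !big_ord_recr big_ord0 /= !small_factorialE; lra.
Qed.

Lemma expRN_ge_cubic (R : realType) (x : R) : 0 <= x ->
  1 - x + x ^+ 2 / 2 - x ^+ 3 / 6 <= expR (- x).
Proof.
move=> x0; have := alternating_partial_sum_expRN _ 4 _ x0.
by rewrite !big_ord_recr big_ord0 /= !small_factorialE; lra.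
Qed.

Lemma expRN_le_quartic (R : realType) (x : R) : 0 <= x ->
  expR (- x) <= 1 - x + x ^+ 2 / 2 - x ^+ 3 / 6 + x ^+ 4 / 24.
Proof.
move=> x0; have := alternating_partial_sum_expRN _ 5 _ x0.
by rewrite !big_ord_recr big_ord0 /= !small_factorialE; lra.
Qed.

(** * The inequality between 3^(-e), y^e and z^e *)

(** Here [x], [y], [z] are exponents: they stand for a lower bound of the logarithm of (1 +
    3/(4(1+e)))^e, an upper bound of minus that of (2(2+e)/(7+4e))^e, and a lower bound of that of
    3^e. Each exponential is replaced by a Taylor polynomial erring on the safe side. *)
Lemma gap_inequality_taylor_polynomials (R : realFieldType) (e : R) :
  0 <= e <= 2 / 5 ->
  let x := e * (559 / 1000 - 43 / 100 * e + e ^+ 2 / 4) in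
  let y := e * (56 / 100 + e / 14) in
  let z := e * (1098 / 1000) in
  2 * (134 / 100) * (1 + e)
    + (1 + e + 134 / 100) *
      (1 - z + z ^+ 2 / 2 - z ^+ 3 / 6 + z ^+ 4 / 24)
  <= (1 + x + x ^+ 2 / 2) * (1 + e + 134 / 100 * (1 + e - 3 / 4 * e))
     + 2 * (134 / 100) * (1 - y + y ^+ 2 / 2 - y ^+ 3 / 6).
Proof.
move=> /andP[e0 e1]; cbv zeta.
(* The difference of the two sides is e * (cubic below) plus terms that are
   nonnegative because e <= 2/5. *)
have p : 0 <= 3 / 100 - 41 / 100 * e ^+ 2 + 58 / 100 * e ^+ 3.
  (* The cubic exceeds this product by 1/500 + e/500 - e^2/125, which is nonnegative for 0 <= e <=
     2/5. *)
  have : 0 <= (2 / 5 - e) * (7 / 100 + 17 / 100 * e - 58 / 100 * e ^+ 2).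
    by apply: mulr_ge0; nra.
  by nra.
have q := mulr_ge0 e0 p.
have e2 : 0 <= e ^+ 2 by exact: sqr_ge0.
have e3 : 0 <= e ^+ 3 by exact: exprn_ge0.
have e4 : 0 <= e ^+ 4 by exact: exprn_ge0.
have e7 : 0 <= e ^+ 7 by exact: exprn_ge0.
have e5 : e ^+ 5 <= e ^+ 2.
  by rewrite (exprD e 2 3) ler_piMr// exprn_ile1//; lra.
have e6 : e ^+ 6 <= e ^+ 2 / 25.
  rewrite (exprD e 2 4) ler_wpM2l// (@le_trans _ _ ((2 / 5) ^+ 4))//; last lra.
  by rewrite lerXn2r ?nnegrE//; lra.
lra.
Qed.

(** For e = 2/m, this turns a lower bound on X^e into a comparison of integer powers. *)
Lemma le_powR_root (R : realType) (m : nat) (r X : R) : (0 < m)%N ->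
  0 <= r -> 0 <= X -> r ^+ m <= X ^+ 2 -> r <= X `^ (2 / m%:R).
Proof.
move=> m0 r0 X0 rX; have m_neq0 : m%:R != 0 :> R by rewrite pnatr_eq0 -lt0n.
rewrite powRrM powR_mulrn//.
have -> : r = (r ^+ m) `^ m%:R^-1.
  by rewrite -powR_mulrn// -powRrM mulfV// powRr1.
by apply: ge0_ler_powR => //; rewrite ?invr_ge0 ?nnegrE ?exprn_ge0.
Qed.

(* (d - 1) / ||f|| >= 1.34 for the choice above, multiplied by u ||f|| / c. *)
Definition gap_inequality (R : realType) (e : R) : bool :=
  2 * (134 / 100) * (1 + e) + (1 + e + 134 / 100) * (3 `^ e)^-1
    <= (1 + 3 / (4 * (1 + e))) `^ e * (1 + e + 134 / 100 * (1 + e - 3 / 4 * e))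
       + 2 * (134 / 100) * (2 * (2 + e) / (7 + 4 * e)) `^ e.

(** The three powers enter with positive coefficients, 3^(-e) on the smaller side and the other two
    on the larger side, which fixes the direction of each bound. *)
Lemma gap_inequality_of_bounds (R : realType) (e r w a : R) : 0 < e ->
  r <= (1 + 3 / (4 * (1 + e))) `^ e ->
  w <= (2 * (2 + e) / (7 + 4 * e)) `^ e ->
  (3 `^ e)^-1 <= a ->
  2 * (134 / 100) * (1 + e) + (1 + e + 134 / 100) * a
    <= r * (1 + e + 134 / 100 * (1 + e - 3 / 4 * e)) + 2 * (134 / 100) * w ->
  gap_inequality R e.
Proof.
move=> e0 rP wP aP H; apply: le_trans (le_trans H _).
  by rewrite lerD2l ler_wpM2l//; lra.
apply: lerD; last by rewrite ler_wpM2l//; lra.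
by rewrite ler_wpM2r//; lra.
Qed.

(** [X] and [Y] bound the two bases from below; [r], [w] and [c] are lower approximations of X^e,
    Y^e and 3^e, certified by integer powers. *)
Lemma gap_inequality_of_roots (R : realType) (m : nat) (e X Y r w c : R) :
  (0 < m)%N -> e = 2 / m%:R ->
  0 <= X -> X * (4 * (1 + e)) <= 7 + 4 * e ->
  0 <= Y -> Y * (7 + 4 * e) <= 2 * (2 + e) ->
  0 <= r -> 0 <= w -> 0 < c ->
  r ^+ m <= X ^+ 2 -> w ^+ m <= Y ^+ 2 -> c ^+ m <= 3 ^+ 2 ->
  2 * (134 / 100) * (1 + e) + (1 + e + 134 / 100) * c^-1
    <= r * (1 + e + 134 / 100 * (1 + e - 3 / 4 * e)) + 2 * (134 / 100) * w ->
  gap_inequality R e.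
Proof.
move=> m0 em X0 XE Y0 YE r0 w0 c0 rP wP cP.
have e0 : 0 < e by rewrite em divr_gt0// ltr0n.
have {}XE : X <= 1 + 3 / (4 * (1 + e)).
  by rewrite -lerBlDl ler_pdivlMr; lra.
have {}YE : Y <= 2 * (2 + e) / (7 + 4 * e) by rewrite ler_pdivlMr; lra.
have pow_e (x y : R) : 0 <= x -> x <= y -> x `^ e <= y `^ e.
  move=> x0 xy; apply: ge0_ler_powR; rewrite ?nnegrE//; first exact: ltW.
  exact: le_trans xy.
apply: gap_inequality_of_bounds => //.
- by apply: le_trans (pow_e _ _ X0 XE); rewrite em; apply: le_powR_root.
- by apply: le_trans (pow_e _ _ Y0 YE); rewrite em; apply: le_powR_root.
- rewrite em lef_pV2 ?posrE ?powR_gt0//; apply: le_powR_root => //; exact: ltW.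
Qed.

Lemma gap_inequality_small (R : realType) (e : R) : 0 < e <= 2 / 5 ->
  gap_inequality R e.
Proof.
move=> /andP[e0 e1]; have e0' := ltW e0.
have [S1 S2] := andP (ln_7_4_bounds R).
have p1 : 0 < 1 + 3 / (4 * (1 + e)) by rewrite addr_gt0// divr_gt0//; lra.
have p2 : 0 < 2 * (2 + e) / (7 + 4 * e) by rewrite divr_gt0//; lra.
have p3 : 0 < 7 / 4 :> R by lra.
have e25 : 0 <= e <= 2 / 5 by rewrite e0' e1.
apply: (gap_inequality_of_bounds _ _ _ _ _ e0 _ _ _
  (gap_inequality_taylor_polynomials _ _ e25)); last first.
- rewrite -powRN powR_expR_ln// mulNr.
  have z0 : 0 <= e * (1098 / 1000) by apply: mulr_ge0; lra.
  apply: le_trans (expRN_le_quartic _ _ z0).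
  by rewrite ler_expR lerN2 ler_wpM2l// ln3_ge.
- rewrite powR_expR_ln//.
  have y0 : 0 <= e * (56 / 100 + e / 14) by apply: mulr_ge0; lra.
  apply: (le_trans (expRN_ge_cubic _ _ y0)).
  rewrite ler_expR -mulrN ler_wpM2l// -[2 * _ / _]invrK lnV ?posrE ?invr_gt0//.
  rewrite lerN2.
  (* 7/4 (1 + e/14) is the tangent at e = 0 of the concave function (7+4e)/(2(2+e)). *)
  apply: (@le_trans _ _ (ln (7 / 4 * (1 + e / 14)))).
    rewrite ler_ln ?posrE ?invr_gt0//; last by apply: mulr_gt0; nra.
    by rewrite invf_div ler_pdivrMr; nra.
  rewrite lnM ?posrE//; last by nra.
  have : ln (1 + e / 14) <= e / 14 by apply: le_ln1Dx; nra.
  lra.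
- rewrite powR_expR_ln//.
  have x0 : 0 <= e * (559 / 1000 - 43 / 100 * e + e ^+ 2 / 4).
    by apply: mulr_ge0; nra.
  apply: (le_trans (expR_ge_quadratic _ _ x0)).
  rewrite ler_expR ler_wpM2l//.
  (* ln(1 + 3/(4(1+e))) - ln(7/4) = -(3/7) e + (33/98) e^2 + ...; in -v the first coefficient is
     rounded to -43/100 and the second down to 1/4. *)
  pose v := 43 / 100 * e - e ^+ 2 / 4.
  have v0 : 0 <= v by rewrite /v; nra.
  rewrite (@le_trans _ _ (ln (7 / 4 * expR (- v))))//.
    by rewrite lnM ?posrE ?expR_gt0// expRK /v; lra.
  rewrite ler_ln ?posrE ?mulr_gt0 ?expR_gt0//.
  apply: (@le_trans _ _ (7 / 4 * (1 - v + v ^+ 2 / 2))).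
    by rewrite ler_wpM2l ?expRN_le_quadratic//; lra.
  have -> : 1 + 3 / (4 * (1 + e)) = (7 / 4 + e) / (1 + e).
    have e1n0 : 1 + e != 0 by lra.
    by rewrite invfM; have := mulVf e1n0; set i := (1 + e)^-1 => ?; lra.
  rewrite ler_pdivlMr; last lra.
  (* 4/7 times the difference of the two sides is at least e^2 times this quadratic. *)
  have h : 0 <= 7 / 80 - 47 / 200 * e + 3 / 50 * e ^+ 2 by nra.
  have h2 := mulr_ge0 (sqr_ge0 e) h.
  have e3 : 0 <= e ^+ 3 by exact: exprn_ge0.
  have e4 : 0 <= e ^+ 4 by exact: exprn_ge0.
  have e5 : e ^+ 5 <= e ^+ 4 * (2 / 5) by rewrite exprSr ler_wpM2l.
  rewrite /v; lra.
Qed.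

Lemma gap_inequality_holds (R : realType) (m : nat) : (0 < m)%N ->
  gap_inequality R (2 / m%:R).
Proof.
case: m => [//|[|[|[|[|m]]]]] _.
(* In the four cases [X] and [Y] are the exact bases; [r], [w], [c] are exact for m = 1, 2 and
   rounded down for m = 3, 4. *)
- by apply: (@gap_inequality_of_roots R 1 _ (5 / 4) (8 / 15)
    (25 / 16) (64 / 225) 9 isT erefl); lra.
- by apply: (@gap_inequality_of_roots R 2 _ (11 / 8) (6 / 11)
    (11 / 8) (6 / 11) 3 isT erefl); lra.
- by apply: (@gap_inequality_of_roots R 3 _ (29 / 20) (16 / 29)
    (128 / 100) (672 / 1000) (208 / 100) isT erefl); lra.
- by apply: (@gap_inequality_of_roots R 4 _ (3 / 2) (5 / 9)
    (1224 / 1000) (745 / 1000) (173 / 100) isT erefl); lra.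
apply: gap_inequality_small; rewrite divr_gt0 ?ltr0n//= ler_pdivrMr ?ltr0n//.
have : 5 <= m.+4.+1%:R :> R by rewrite ler_nat.
lra.
Qed.

(** * Integrals of powers and of two-term sums of powers *)

Lemma continuous_powR_within (R : realType) (a c q : R) : 0 < a ->
  {within `[a, c], continuous (fun s : R => s `^ q)}.
Proof.
move=> a0; apply: derivable_within_continuous => x.
rewrite in_itv/= => /andP[ax _].
by apply: derivable_powR; rewrite in_itv/= (lt_le_trans a0 ax).
Qed.

Lemma integrable_powR (R : realType) (a c q : R) : 0 < a ->
  (@lebesgue_measure R).-integrable `]a, c] (EFin \o (fun s => s `^ q)).
Proof.
move=> a0; have : (@lebesgue_measure R).-integrable `[a, c]
    (EFin \o (fun s => s `^ q)).
  apply: continuous_compact_integrable; first exact: segment_compact.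
  exact: continuous_powR_within.
by apply: integrableS => //; exact: subset_itv_oc_cc.
Qed.

Lemma Rintegral_powR (R : realType) (a c q : R) : 0 < a -> a <= c -> 0 <= q ->
  \int[@lebesgue_measure R]_(s in `]a, c]) (s `^ q)
    = (c `^ (q + 1) - a `^ (q + 1)) / (q + 1).
Proof.
move=> a0; rewrite le_eqVlt => /predU1P[<- _|ac q0].
  by rewrite set_itv_ge ?bnd_simp ?ltxx// Rintegral_set0 subrr mul0r.
have q1 : q + 1 != 0 by lra.
rewrite Rintegral_itv_obnd_cbnd; last exact: integrable_powR.
pose F (s : R) : R := (q + 1)^-1 * s `^ (q + 1).
have dF (x : R) : 0 < x -> is_derive x 1 F (x `^ q).
  move=> x0; have := is_derive1_powR (q + 1) x0 => dP.
  apply: is_derive_eq.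
  by rewrite /GRing.scale/= addrK mulrA mulVf// mul1r.
rewrite /Rintegral (@continuous_FTC2 _ _ F)//=.
- by rewrite /F mulrBl ![_ / _]mulrC.
- exact: continuous_powR_within.
- have cF : {within `[a, c], continuous F}.
    apply: derivable_within_continuous => x; rewrite in_itv/= => /andP[ax _].
    exact/ex_derive/dF/(lt_le_trans a0 ax).
  have [_ cl cr] := (continuous_within_itvP _ ac).1 cF.
  split => // x; rewrite in_itv/= => /andP[ax _].
  exact/ex_derive/dF/(lt_trans a0 ax).
- move=> x; rewrite in_itv/= => /andP[ax _].
  by rewrite derive1E; have [_ ->] := dF _ (lt_trans a0 ax).
Qed.

(** All pieces of f, of |f| and of f(s) s^p have this shape, a constant being written as a multiple
    of s^0. *)
Lemma integrable_binomial (R : realType) (a c q q' A B : R) : 0 < a ->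
  (@lebesgue_measure R).-integrable `]a, c]
    (EFin \o (fun s => A * s `^ q + B * s `^ q')).
Proof.
move=> a0.
have -> : EFin \o (fun s : R => A * s `^ q + B * s `^ q') =
    ((fun s => A%:E * (s `^ q)%:E) \+ (fun s => B%:E * (s `^ q')%:E))%E.
  by apply/funext => s /=; rewrite EFinD !EFinM.
by apply: integrableD => //; apply: integrableZl => //; exact: integrable_powR.
Qed.

Lemma Rintegral_binomial (R : realType) (a c q q' A B : R) :
  0 < a -> a <= c -> 0 <= q -> 0 <= q' ->
  \int[@lebesgue_measure R]_(s in `]a, c]) (A * s `^ q + B * s `^ q')
    = A * ((c `^ (q + 1) - a `^ (q + 1)) / (q + 1))
      + B * ((c `^ (q' + 1) - a `^ (q' + 1)) / (q' + 1)).
Proof.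
move=> a0 ac q0 q'0.
have i0 C r : (@lebesgue_measure R).-integrable `]a, c]
    (EFin \o (fun s => C * s `^ r)).
  have -> : EFin \o (fun s : R => C * s `^ r) = (fun s => C%:E * (s `^ r)%:E)%E.
    by apply/funext => s /=; rewrite EFinM.
  by apply: integrableZl => //; exact: integrable_powR.
rewrite RintegralD// !RintegralZl ?Rintegral_powR//; exact: integrable_powR.
Qed.

(** * Integrals of sums of restricted functions *)

Lemma integrable_patch (d : measure_display) (T : measurableType d)
    (R : realType) (mu : {measure set T -> \bar R}) (D E : set T) (k : T -> R) :
  measurable D -> measurable E ->
  mu.-integrable D (EFin \o k) ->
  mu.-integrable E (EFin \o (k \_ D)).
Proof.
move=> mD mE ik.
rewrite -restrict_EFin.
by have := (integrable_mkcond _ mD).1 ik; exact: integrableS.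
Qed.

Lemma integrable_patchD (d : measure_display) (T : measurableType d)
    (R : realType) (mu : {measure set T -> \bar R}) (D1 D2 E : set T)
    (k1 k2 : T -> R) :
  measurable D1 -> measurable D2 -> measurable E ->
  mu.-integrable D1 (EFin \o k1) -> mu.-integrable D2 (EFin \o k2) ->
  mu.-integrable E (EFin \o (fun s => (k1 \_ D1) s + (k2 \_ D2) s)).
Proof.
move=> mD1 mD2 mE i1 i2.
have -> : EFin \o (fun s => (k1 \_ D1) s + (k2 \_ D2) s)
    = ((EFin \o (k1 \_ D1)) \+ (EFin \o (k2 \_ D2)))%E.
  by apply/funext => s /=; rewrite EFinD.
by apply: integrableD => //; apply: integrable_patch.
Qed.

Lemma Rintegral_patchD (d : measure_display) (T : measurableType d)
    (R : realType) (mu : {measure set T -> \bar R}) (D1 D2 E : set T)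
    (k1 k2 : T -> R) :
  measurable D1 -> measurable D2 -> measurable E ->
  mu.-integrable D1 (EFin \o k1) ->
  mu.-integrable D2 (EFin \o k2) ->
  \int[mu]_(s in E) ((k1 \_ D1) s + (k2 \_ D2) s)
    = \int[mu]_(s in E `&` D1) k1 s
      + \int[mu]_(s in E `&` D2) k2 s.
Proof.
move=> mD1 mD2 mE i1 i2; rewrite RintegralD//; [|exact: integrable_patch..].
by rewrite !Rintegral_mkcondr.
Qed.

Lemma setI_itvcc_itvoc (R : realType) (a c t : R) : 0 <= a ->
  `[0, t] `&` `]a, c] = `]a, Num.min t c]%classic.
Proof.
move=> a0; apply/seteqP; split => s /=; rewrite !in_itv/= le_min.
  by move=> [/andP[_ ->] /andP[-> ->]].
by move=> /and3P[as_ -> ->]; rewrite as_ (le_trans a0 (ltW as_)).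
Qed.

Lemma powRD1 (R : realType) (t q : R) : 0 < t -> t `^ (q + 1) = t `^ q * t.
Proof.
by move=> t0; rewrite powRD ?powRr1 ?ltW// (gt_eqF t0) implybT.
Qed.

(** * Moments of the extremal function and its image under [Lambda] *)

Section extremal.
Variables (R : realType) (p b d : R).
Hypotheses (p0 : 0 < p) (b1 : 1 < b) (bd : b <= d).

Let e := p^-1.
Let u := 1 + e.

(** This is the equation D = u/3, that is (1+u)(2 b^(-p) - 1) = u/3, cleared of denominators. *)
Hypothesis bp : b `^ p * (3 + 4 * u) = 6 * (1 + u).

Definition extremal_fun (t : R) : R :=
  (u - (1 + u) * t `^ p) * \1_(`]1, b]%classic) t
  + (- u + u / 3 * t `^ p) * \1_(`]b, d]%classic) t.

Let h1 (s : R) : R := u * s `^ 0 + - (1 + u) * s `^ p.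
Let h2 (s : R) : R := - u * s `^ 0 + u / 3 * s `^ p.

Lemma extremal_funE (t : R) :
  extremal_fun t = (h1 \_ `]1, b]) t + (h2 \_ `]b, d]) t.
Proof.
by rewrite !patch_indic /extremal_fun /h1 /h2/= powRr0 !mulr1 mulNr.
Qed.

Let e0 : 0 < e. Proof. by rewrite invr_gt0. Qed.
Let pe : p * e = 1. Proof. by rewrite mulfV// gt_eqF. Qed.
Let b0 : 0 < b. Proof. exact: lt_trans b1. Qed.

Let P1 := (p + 1)^-1.
Let P2 := (p + p + 1)^-1.

(** As u = (p+1)/p and 1 + u = (2p+1)/p, the primitives of u s^p and (1+u) s^(2p) share the leading
    coefficient e. *)
Let uP1 : u * P1 = e.
Proof.
have q : p + 1 != 0 by rewrite gt_eqF ?ltr_wpDl ?ltW.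
apply: (mulIf q); rewrite -mulrA mulVf// mulr1 /u mulrDr mulr1 (mulrC e p) pe.
by lra.
Qed.

Let uP2 : (1 + u) * P2 = e.
Proof.
have q : p + p + 1 != 0 by rewrite gt_eqF ?ltr_wpDl ?addr_ge0 ?ltW.
apply: (mulIf q); rewrite -mulrA mulVf// mulr1 /u !mulrDr mulr1 !(mulrC e p) pe.
by lra.
Qed.

(** The minima let one formula cover both ranges of t: for t <= b the second interval is empty. *)
Let extremal_moment (t : R) :
  \int[@lebesgue_measure R]_(s in `[0, t]) (extremal_fun s * s `^ p)
  = \int[@lebesgue_measure R]_(s in `]1, Num.min t b])
      (u * s `^ p + - (1 + u) * s `^ (p + p))
    + \int[@lebesgue_measure R]_(s in `]b, Num.min t d])
      (- u * s `^ p + u / 3 * s `^ (p + p)).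
Proof.
rewrite -(setI_itvcc_itvoc _ _ _ _ ler01) -(setI_itvcc_itvoc _ _ _ _ (ltW b0)).
rewrite -Rintegral_patchD//; [|exact: integrable_binomial..].
apply: eq_Rintegral => s _; rewrite extremal_funE !patch_indic/= mulrDl.
have sp : 0 < s -> s `^ (p + p) = s `^ p * s `^ p.
  by move=> s0; rewrite powRD// (gt_eqF s0) implybT.
congr (_ + _); rewrite indicE; (have [|_] := boolP (s \in _);
    last by rewrite !mulr0 mul0r); rewrite inE/= in_itv/= => /andP[s1 _].
  by rewrite !mulr1 /h1 powRr0 sp; [lra|exact: lt_trans s1].
by rewrite !mulr1 /h2 powRr0 sp; [lra|exact: lt_trans s1].
Qed.

(** Both primitives have coefficient e, so their contributions at the endpoint 1 cancel. *)
Lemma extremal_moment_left (t : R) : 1 < t <= b ->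
  \int[@lebesgue_measure R]_(s in `[0, t]) (extremal_fun s * s `^ p)
  = e * (t `^ p * t) * (1 - t `^ p).
Proof.
move=> /andP[t1 tb]; rewrite extremal_moment.
have t0 : 0 < t by exact: lt_trans t1.
have -> : Num.min t b = t by apply/min_idPl.
have -> : Num.min t d = t by apply/min_idPl; exact: le_trans bd.
rewrite (@set_itv_ge _ _ (BRight b)) ?bnd_simp -?leNgt// Rintegral_set0 addr0.
have pp0 : 0 <= p + p by rewrite addr_ge0 ?ltW.
rewrite Rintegral_binomial// ?(ltW t1) ?(ltW p0)// !powR1.
rewrite !powRD1// powRD ?(gt_eqF t0) ?implybT//.
rewrite -/P1 -/P2.
transitivity ((u * P1) * (t `^ p * t - 1)
  - ((1 + u) * P2) * (t `^ p * t `^ p * t - 1)); first by lra.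
by rewrite uP1 uP2; lra.
Qed.

(** The contributions at 1 cancel as before, and those at b cancel by [bp]. *)
Lemma extremal_moment_right (t : R) : b < t <= d ->
  \int[@lebesgue_measure R]_(s in `[0, t]) (extremal_fun s * s `^ p)
  = (t `^ p * t) * (u / 3 / (p + p + 1) * t `^ p - e).
Proof.
move=> /andP[bt td]; rewrite extremal_moment.
have t0 : 0 < t by exact: lt_trans bt.
have -> : Num.min t b = b by apply/min_idPr; exact: ltW.
have -> : Num.min t d = t by apply/min_idPl.
have pp0 : 0 <= p + p by rewrite addr_ge0 ?ltW.
rewrite !Rintegral_binomial// ?(ltW b1) ?(ltW p0) ?(ltW bt)// !powR1.
rewrite !powRD1// !powRD ?(gt_eqF t0) ?(gt_eqF b0) ?implybT//.
rewrite -/P1 -/P2.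
move: bp; set x := b `^ p; set T := t `^ p => xu.
transitivity ((u * P1) * (2 * (x * b) - 1 - T * t)
  - ((1 + u) * P2) * (x * x * b - 1) + u / 3 * P2 * (T * T * t - x * x * b)).
  by lra.
rewrite uP1 uP2.
(* Multiplying [bp] by this factor produces the monomials in b that remain, so that linear
   arithmetic can finish. *)
have : P2 * (x * b) * (x * (3 + 4 * u)) = P2 * (x * b) * (6 * (1 + u)).
  by rewrite xu.
have -> : P2 * (x * b) * (6 * (1 + u)) = 6 * e * (x * b) by rewrite -uP2; lra.
have -> : P2 * (x * b) * (x * (3 + 4 * u))
   = (x * b) * x * (3 * ((1 + u) * P2) + u * P2) by lra.
by rewrite uP2; lra.
Qed.

(** Since (2p+1) e = 1 + u, the averaging term is (1+u)(1 - t^p) on (1,b] and (u/3) t^p - (1+u) on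
    (b,d]; subtracting f leaves 1 and -1. *)
Lemma Lambda_extremal (m : nat) (t : R) : p = m%:R / 2 -> 1 < t <= d ->
  `|Lambda m extremal_fun t| = 1.
Proof.
move=> pm /andP[t1 td]; have t0 : 0 < t by exact: lt_trans t1.
have Tt0 : t `^ p * t != 0 by rewrite mulf_neq0 ?gt_eqF ?powR_gt0.
have q : p + p + 1 != 0 by rewrite gt_eqF ?ltr_wpDl ?addr_ge0 ?ltW.
have -> : Lambda m extremal_fun t = (p + p + 1) / (t `^ p * t)
    * (\int[@lebesgue_measure R]_(s in `[0, t]) (extremal_fun s * s `^ p))
    - extremal_fun t.
  rewrite /Lambda -pm -powRD1// (addrC p 1); congr (_ / _ * _ - _).
  by rewrite pm; lra.
have [tb|bt] := leP t b.
  rewrite extremal_moment_left ?t1// /extremal_fun !indicE !mem_setE !in_itv/=.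
  rewrite t1 tb ltNge tb/= mulr1 mulr0 addr0.
  have -> : (p + p + 1) / (t `^ p * t) * (e * (t `^ p * t) * (1 - t `^ p))
      = (p + p + 1) * e * (1 - t `^ p) * ((t `^ p * t)^-1 * (t `^ p * t)).
    by lra.
  rewrite mulVf// mulr1 -uP2 (mulrCA _ (1 + u)) mulfV// mulr1.
  have -> : (1 + u) * (1 - t `^ p) - (u - (1 + u) * t `^ p) = 1 by lra.
  by rewrite normr1.
rewrite extremal_moment_right ?bt// /extremal_fun !indicE !mem_setE !in_itv/=.
rewrite t1 bt td leNgt bt/= mulr1 mulr0 add0r.
have -> : (p + p + 1) / (t `^ p * t)
    * (t `^ p * t * (u / 3 / (p + p + 1) * t `^ p - e))
    = ((p + p + 1) * (p + p + 1)^-1 * (u / 3) * t `^ p - (p + p + 1) * e)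
      * ((t `^ p * t)^-1 * (t `^ p * t)).
  by lra.
rewrite mulVf// mulr1 -uP2 (mulrCA _ (1 + u)) mulfV// mulr1 mul1r.
have -> : u / 3 * t `^ p - (1 + u) - (- u + u / 3 * t `^ p) = - 1 by lra.
by rewrite normrN1.
Qed.

(** * The norm of the extremal function and the weak-type ratio *)

Variable c : R.
Hypotheses (bc : b <= c) (cd : c <= d) (cp : c `^ p = 3).

Let powRp_homo (s t : R) : 0 <= s -> s <= t -> s `^ p <= t `^ p.
Proof.
move=> s0 st; apply: ge0_ler_powR; rewrite ?nnegrE//; first exact: ltW.
exact: le_trans st.
Qed.

(** [k1] and [k2] are the opposites of [h1] and [h2]: they give |f| on (1,b] and (b,c], where f is
    nonpositive. *)
Let k1 (s : R) : R := - u * s `^ 0 + (1 + u) * s `^ p.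
Let k2 (s : R) : R := u * s `^ 0 + - (u / 3) * s `^ p.

Let u0 : 0 < u. Proof. by rewrite /u addr_gt0. Qed.

(** The expression is nondecreasing in s and equals 1 at s = 1. This bound also yields the
    positivity of the norm. *)
Let k1_ge1 (s : R) : 1 < s <= b -> 1 <= k1 s.
Proof.
move=> /andP[s1 _]; have := powRp_homo _ _ ler01 (ltW s1).
rewrite powR1 /k1 powRr0 => /(ler_wpM2l (addr_ge0 ler01 (ltW u0))).
by lra.
Qed.

Let k2_ge0 (s : R) : b < s <= c -> 0 <= k2 s.
Proof.
move=> /andP[bs sc]; have := powRp_homo _ _ (ltW (lt_trans b0 bs)) sc.
rewrite cp /k2 powRr0 => /(ler_wpM2l (ltW u0)).
by lra.
Qed.

Let h2_ge0 (s : R) : c < s <= d -> 0 <= h2 s.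
Proof.
move=> /andP[cs sd].
have := powRp_homo _ _ (le_trans (ltW b0) bc) (ltW cs).
rewrite cp /h2 powRr0 => /(ler_wpM2l (ltW u0)).
by lra.
Qed.

Let normr_extremal (t : R) : `|extremal_fun t|
  = (k1 \_ `]1, b]) t + (k2 \_ `]b, c]) t + (h2 \_ `]c, d]) t.
Proof.
rewrite extremal_funE !patch_indic/= !indicE !mem_setE !in_itv/=.
have [tb|bt] := leP t b.
  rewrite (ltNge c) (le_trans tb bc)/= ?andbT ?andbF !mulr0 !addr0.
  have [t1|_] := ltP 1 t; last by rewrite !mulr0 normr0.
  have h : h1 t = - k1 t by rewrite /h1 /k1; lra.
  by rewrite !mulr1 h normrN ger0_norm// (le_trans ler01)// k1_ge1 ?t1.
rewrite ?andbF/= !mulr0 !add0r.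
have [tc|ct] := leP t c.
  have h : h2 t = - k2 t by rewrite /h2 /k2; lra.
  rewrite (le_trans tc cd) /= !mulr1 mulr0 addr0 h normrN ger0_norm//.
  by rewrite k2_ge0 ?bt.
rewrite mulr0 add0r; have [td|_] := leP t d; last by rewrite !mulr0 normr0.
by rewrite !mulr1 ger0_norm// h2_ge0 ?ct.
Qed.

Let c0 : 0 < c. Proof. exact: lt_le_trans bc. Qed.

Let measurable_halfline : measurable (halfline R).
Proof. exact: measurable_itv. Qed.

Let halfline_itv (a z : R) : 0 < a -> halfline R `&` `]a, z] = `]a, z]%classic.
Proof.
move=> a0; apply: setIidr => s; rewrite /halfline/= !in_itv/= => /andP[as_ _].
by rewrite (ltW (lt_trans a0 as_)).
Qed.

Lemma extremal_fun_L1 : L1 R extremal_fun.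
Proof.
have -> : extremal_fun = (fun t => (h1 \_ `]1, b]) t + (h2 \_ `]b, d]) t).
  by apply/funext => t; exact: extremal_funE.
rewrite /L1/=; apply: integrable_patchD => //; exact: integrable_binomial.
Qed.

Let N := \int[@lebesgue_measure R]_(s in `]1, b]) k1 s
  + \int[@lebesgue_measure R]_(s in `]b, c]) k2 s
  + \int[@lebesgue_measure R]_(s in `]c, d]) h2 s.

Let norm1_extremal_fun : norm1 extremal_fun = N%:E.
Proof.
rewrite /norm1 -[LHS]fineK; last first.
  exact: integrable_fin_num (integrable_norm extremal_fun_L1).
congr EFin.
change (\int[@lebesgue_measure R]_(t in halfline R) `|extremal_fun t| = N).
under eq_Rintegral do rewrite normr_extremal.
have i1 := @integrable_binomial R 1 b 0 p (- u) (1 + u) ltr01.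
have i2 := @integrable_binomial R b c 0 p u (- (u / 3)) b0.
have i3 := @integrable_binomial R c d 0 p (- u) (u / 3) c0.
rewrite RintegralD//; last 2 first.
- exact: integrable_patchD.
- exact: integrable_patch.
by rewrite Rintegral_patchD// -Rintegral_mkcondr !halfline_itv.
Qed.

(** The piece over (1,b] alone contributes at least b - 1. *)
Let N_gt0 : 0 < N.
Proof.
have I1 : b - 1 <= \int[@lebesgue_measure R]_(s in `]1, b]) k1 s.
  have -> : b - 1 = \int[@lebesgue_measure R]_(s in `]1, b]) (1 : R).
    rewrite Rintegral_cst//= mul1r lebesgue_measure_itv/= lte_fin b1.
    by rewrite -EFinB.
  apply: le_Rintegral => //.
  - have -> : (fun _ : R => 1 : R) = (fun s => 1 * s `^ 0 + 0 * s `^ 0).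
      by apply/funext => s; rewrite powRr0 mulr1 mul0r addr0.
    exact: integrable_binomial.
  - exact: integrable_binomial.
have I2 : 0 <= \int[@lebesgue_measure R]_(s in `]b, c]) k2 s.
  by apply: Rintegral_ge0 => s /=; rewrite in_itv/=; exact: k2_ge0.
have I3 : 0 <= \int[@lebesgue_measure R]_(s in `]c, d]) h2 s.
  by apply: Rintegral_ge0 => s /=; rewrite in_itv/=; exact: h2_ge0.
apply: ltr_wpDr => //; apply: ltr_wpDr => //.
by apply: lt_le_trans I1; rewrite subr_gt0.
Qed.

Lemma norm1_extremal_fun_gt0 : (0 < norm1 extremal_fun)%E.
Proof. by rewrite norm1_extremal_fun lte_fin. Qed.

(** The hypothesis says f(d) = 3/4. Together with [bp] and [cp] it eliminates the p-th powers of b,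
    c and d, leaving an expression linear in b, c, d. *)
Let N_closed_form : u * (d `^ p) = 3 * u + 9 / 4 ->
  u * N = 2 * u * c - 2 * b + 1 - d * (u - 3 / 4 * e).
Proof.
move=> du; have d0 : 0 < d by exact: lt_le_trans cd.
rewrite /N !Rintegral_binomial// ?(ltW b1) ?(ltW p0)// add0r !powRr1 ?ltW//.
rewrite !powR1 !powRD1// cp invr1 !mulr1 -/P1.
move: bp du; set x := b `^ p; set z := d `^ p => xu zu.
transitivity (- u * u * (b - 1) + (1 + u) * (u * P1) * (x * b - 1)
  + u * u * (c - b) - u / 3 * (u * P1) * (3 * c - x * b)
  - u * u * (d - c) + u / 3 * (u * P1) * (z * d - 3 * c)); first by lra.
rewrite uP1.
have : e * b * (x * (3 + 4 * u)) = e * b * (6 * (1 + u)) by rewrite xu.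
have : e * d * (u * z) = e * d * (3 * u + 9 / 4) by rewrite zu.
by rewrite /u; lra.
Qed.

Lemma measure_extremal_level (m : nat) : p = m%:R / 2 ->
  ((d - 1)%:E <= @lebesgue_measure R
    [set t | halfline R t /\ (1 <= `|Lambda m extremal_fun t|)%R])%E.
Proof.
move=> pm; have d1 : 1 < d by exact: lt_le_trans bd.
have -> : (d - 1)%:E = @lebesgue_measure R `]1, d].
  by rewrite lebesgue_measure_itv/= lte_fin d1 EFinB.
(* [lebesgue_measure] is an outer measure on all sets, so monotonicity does not
   require the level set to be measurable. *)
apply: le_mu_ext => t /=; rewrite in_itv/= => /andP[t1 td]; split.
  by rewrite /halfline/= in_itv/= (le_trans ler01 (ltW t1)).
by rewrite Lambda_extremal ?t1.
Qed.

Lemma extremal_ratio (m : nat) (K : R) : p = m%:R / 2 ->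
  u * (d `^ p) = 3 * u + 9 / 4 ->
  K * (2 * u * c - 2 * b + 1 - d * (u - 3 / 4 * e)) <= u * (d - 1) ->
  (K%:E <= @lebesgue_measure R
    [set t | halfline R t /\ (1 <= `|Lambda m extremal_fun t|)%R]
    / norm1 extremal_fun)%E.
Proof.
move=> pm du; rewrite -(N_closed_form du) mulrCA ler_pM2l// => KN.
(* Because N is nonzero, the extended inverse is the real one. *)
rewrite norm1_extremal_fun inver gt_eqF// lee_pdivlMr// -EFinM.
by apply: le_trans (measure_extremal_level _ pm); rewrite lee_fin.
Qed.

End extremal.

(** * Choice of the parameters and conclusion *)

Theorem theoremB1 (R : realType) (m : nat) (hm : (0 < m)%N) :
  ((134%:R / 100%:R : R)%:E <= weak_const (@Lambda R m) (Fclass R m))%E.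
Proof.
have m0 : 0 < m%:R :> R by rewrite ltr0n.
have gap := gap_inequality_holds R m hm.
(* The parameters become variables known only through equations, hence atoms for the arithmetic
   tactics. *)
have [p pE] : exists p : R, p = m%:R / 2 by exists (m%:R / 2).
have p0 : 0 < p by rewrite pE divr_gt0.
have [e eE] : exists e : R, e = 2 / m%:R by exists (2 / m%:R).
have e0 : 0 < e by rewrite eE divr_gt0.
have pVE : p^-1 = e by rewrite pE eE invf_div.
have [y yE] : exists y : R, y = 2 * (2 + e) / (7 + 4 * e) by eexists.
have [z zE] : exists z : R, z = 1 + 3 / (4 * (1 + e)) by eexists.
rewrite /gap_inequality -eE -yE -zE in gap.
have y0 : 0 < y by rewrite yE divr_gt0//; lra.
have z1 : 1 < z by rewrite zE ltrDl divr_gt0//; lra.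
have {}yE : y * (7 + 4 * e) = 2 * (2 + e) by rewrite yE divfK// gt_eqF//; lra.
have {}zE : z * (4 * (1 + e)) = 4 * (1 + e) + 3.
  by rewrite zE mulrDl mul1r divfK// gt_eqF//; lra.
have powK (x : R) : 0 < x -> (x `^ e) `^ p = x.
  by move=> x0; rewrite -powRrM -pVE mulVf ?gt_eqF// powRr1// ltW.
have lt_powe (s t : R) : 0 <= s -> s < t -> s `^ e < t `^ e.
  move=> s0 st; apply: gt0_ltr_powR; rewrite ?nnegrE//.
  exact: le_trans (ltW st).
have [c [cE c0 cp]] : exists c : R, [/\ c = 3 `^ e, 0 < c & c `^ p = 3].
  by exists (3 `^ e); split; rewrite ?powR_gt0// powK.
(* 1 < b and b < c amount to 3y > 1 and y < 1. *)
have [b [bE b1 bc bp]] : exists b : R,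
    [/\ b = c * y `^ e, 1 < b, b < c & b `^ p = 3 * y].
  exists ((3 * y) `^ e); split.
  - by rewrite powRM ?cE// ltW.
  - by have := lt_powe 1 (3 * y) ler01; rewrite powR1; apply; nra.
  - by rewrite cE; apply: lt_powe; nra.
  - by apply: powK; rewrite mulr_gt0.
have [d [dE cd dp]] : exists d : R, [/\ d = c * z `^ e, c < d & d `^ p = 3 * z].
  have z0 : 0 < z by exact: lt_trans z1.
  exists ((3 * z) `^ e); split.
  - by rewrite powRM ?cE// ltW.
  - by rewrite cE; apply: lt_powe => //; lra.
  - by apply: powK; rewrite mulr_gt0.
have uE : (2 + m%:R) / m%:R = 1 + e.
  by rewrite mulrDl mulfV ?gt_eqF// addrC eE.
have u1E : 2 * (1 + m%:R) / m%:R = 1 + (1 + e).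
  by rewrite mulrDr mulr1 mulrDl mulfK ?gt_eqF// addrC addrA eE.
have bp' : b `^ p * (3 + 4 * (1 + p^-1)) = 6 * (1 + (1 + p^-1)).
  by rewrite bp pVE; lra.
have DE : Dcoef m b = (1 + e) / 3.
  rewrite /Dcoef u1E powRN -pE bp.
  have y30 : 3 * y != 0 by rewrite gt_eqF ?mulr_gt0.
  apply: (mulIf y30); rewrite -mulrA mulrBl -mulrA mulVf//.
  by lra.
have du : (1 + p^-1) * d `^ p = 3 * (1 + p^-1) + 9 / 4.
  by rewrite dp pVE; lra.
have bd := ltW (lt_trans bc cd).
have ratio := extremal_ratio R p b d p0 b1 bd bp' c (ltW bc) (ltW cd) cp m
  (134 / 100) pE du.
have norm_gt0 := norm1_extremal_fun_gt0 R p b d p0 b1 c (ltW bc) (ltW cd) cp.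
apply: (@le_trans _ _ _ _ _ (ratio _)).
  (* With b = c y^e and d = c z^e the goal is c times [gap]; the constants free of c arise as c
     c^(-1). *)
  rewrite pVE bE dE -subr_ge0.
  have cc : c * c^-1 = 1 by rewrite mulfV// gt_eqF.
  rewrite -cE -subr_ge0 in gap.
  have := mulr_ge0 (ltW c0) gap.
  set Y := y `^ e; set Z := z `^ e.
  have -> : c * (Z * (1 + e + 134 / 100 * (1 + e - 3 / 4 * e))
      + 2 * (134 / 100) * Y
      - (2 * (134 / 100) * (1 + e) + (1 + e + 134 / 100) / c))
    = c * (Z * (1 + e + 134 / 100 * (1 + e - 3 / 4 * e))
      + 2 * (134 / 100) * Y - 2 * (134 / 100) * (1 + e))
      - (1 + e + 134 / 100) * (c * c^-1) by lra.
  by rewrite cc; lra.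
apply: ereal_sup_ubound; exists (extremal_fun R p b d) => //; split; last first.
  by apply/eqP; rewrite gt_eqF.
split; last exact: extremal_fun_L1.
exists b, d; split => //; first exact: lt_trans cd.
- by rewrite DE divr_gt0//; lra.
(* The values at b and d are u (y - 1) and 3/4. *)
- rewrite DE uE -pE bp dp; split; first by nra.
  by apply/andP; split; nra.
- by move=> t _; rewrite DE uE u1E -pE /extremal_fun pVE.
Qed.
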